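(* Let $n > 1$ be an integer with $n \equiv 1 \pmod{4}$. Then $h(n) = (n-1)/2$.
   Context: $A_n$ is the alternating group of degree $n$, acting on $\mathbb{Z}_n = \mathbb{Z}/n\mathbb{Z} = \{0,1,\ldots,n-1\}$. Permutations act on the right (the image of $x$ under $\pi$ is $x^\pi$) and are composed from left to right. For $n$ odd, let $c = (0,1,\ldots,n-1) \in A_n$, i.e. $x^c = x+1$. For $\pi \in A_n$, $[\pi] = \langle c\rangle \pi$ is the coset of $\langle c \rangle$ containing $\pi$; its elements are the permutations $c^j\pi$ (first $c^j$, then $\pi$). Define $h(\pi)$ to be the minimum number of 3-cycles in an expression of $\pi$ as a product of (not necessarily disjoint) 3-cycles in $A_n$, with $h(\mathrm{id}) = 0$. Define $h([\pi]) = \min_{\sigma \in [\pi]} h(\sigma) = \min_{0 \le j \le n-1} h(c^j\pi)$ and $h(n) = \max_{\pi \in A_n} h([\pi])$. *)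

(* Defs.v *)
#[warnings="-notation-overridden"]
From mathcomp Require Import all_boot all_fingroup all_solvable.

Set Implicit Arguments.
Unset Strict Implicit.
Unset Printing Implicit Defensive.

Import GroupScope.

(* 'I_n, with successor modulo n, plays the role of Z/nZ. The product of
   {perm 'I_n} is composition from left to right: (s * t) x = t (s x). *)
Definition shift (n : nat) : {perm 'I_n} := perm (@ordS_inj n).

Definition is_three_cycle (n : nat) (s : {perm 'I_n}) : bool :=
  [exists x, exists y, exists z,
    [&& x != y, y != z, z != x, s x == y, s y == z, s z == x
      & perm_on [set x; y; z] s]].

Definition three_cycles (n : nat) : {set {perm 'I_n}} :=
  [set s | is_three_cycle s].

Lemma tpermM_three_cycles (n : nat) (a b c : 'I_n) :
  a != b -> b != c -> tperm a b * tperm b c \in <<three_cycles n>>.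
Proof.
move=> ab bc; have [<-|ac] := eqVneq a c.
  by rewrite [tperm b a]tpermC tperm2 group1.
have sa : (tperm a b * tperm b c) a = c by rewrite permM !tpermL.
have sb : (tperm a b * tperm b c) b = a.
  by rewrite permM tpermR tpermD // eq_sym.
have sc : (tperm a b * tperm b c) c = b.
  by rewrite permM (tpermD ac bc) tpermR.
apply: mem_gen; rewrite inE; apply/existsP; exists a; apply/existsP; exists c.
apply/existsP; exists b; rewrite ac eq_sym bc eq_sym ab sa sb sc !eqxx /=.
apply/subsetP=> x; rewrite !inE; apply: contraR; rewrite !negb_or.
case/andP=> /andP[xa xc] xb.
by rewrite permM (@tpermD _ a b x) ?(@tpermD _ b c x) // eq_sym.
Qed.

Lemma Alt_sub_gen_three_cycles (n : nat) :
  'Alt_('I_n) \subset <<three_cycles n>>.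
Proof.
apply/subsetP=> s; rewrite Alt_even; have [ts -> dts] := prod_tpermP s.
rewrite odd_perm_prod //.
have [m] := ubnP (size ts); elim: m ts dts => // m IHm.
case=> [|[a b] [|[c d] ts]] //=; first by rewrite big_nil group1.
case/and3P=> ab cd dts lt_m; rewrite negbK => ev.
rewrite !big_cons mulgA groupM //; last by apply: IHm => //; apply: ltnW.
rewrite /dpair /= in ab cd *.
have [bc|bc] := eqVneq b c.
  by rewrite -bc in cd *; apply: tpermM_three_cycles.
rewrite -[tperm a b](mulgK (tperm b c)) tpermV -mulgA.
by rewrite groupM // tpermM_three_cycles.
Qed.

(* X ^+ k is the set of all products of k elements of X. *)
Lemma ex_three_cycle_product (n : nat) (s : {perm 'I_n}) :
  exists k, (s \in 'Alt_('I_n)) ==> (s \in three_cycles n ^+ k).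
Proof.
have [sA | _] := boolP (s \in 'Alt_('I_n)); last by exists 0.
have /gen_prodgP[k [c cP ->]] := subsetP (Alt_sub_gen_three_cycles n) s sA.
exists k => /=; elim: k c cP => [|k IHk] c cP.
  by rewrite big_ord0 expg0 inE.
by rewrite big_ord_recl expgS mem_mulg // IHk.
Qed.

(* The value on odd permutations, for which no such product exists, is 0. *)
Definition h_perm (n : nat) (s : {perm 'I_n}) : nat :=
  ex_minn (ex_three_cycle_product s).

(* <[shift n]> :* s consists of the products shift n ^+ j * s. As s is in this
   coset, the neutral value h_perm s does not affect the minimum. *)
Definition h_coset (n : nat) (s : {perm 'I_n}) : nat :=
  \big[minn/h_perm s]_(t in <[shift n]> :* s) h_perm t.

Definition h_max (n : nat) : nat :=
  \max_(s in 'Alt_('I_n)) h_coset s.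

(* Main.v *)
Require Import Defs.
From mathcomp Require Import all_boot all_fingroup all_solvable.
From mathcomp Require Import zify.

(** The reflection [x |-> n-1-x] is even because [n = 1 mod 4], and composing it
with a rotation yields an involution with at most one fixed point. For a product
of [k] 3-cycles, starting from singletons and merging at each 3-cycle the blocks
that it meets gives an invariant partition; a merge destroys at most two blocks
of odd size, so at least [n - 2k] remain. An odd invariant block of an involution
contains a fixed point, whence [n - 2k <= 1]. Conversely, an even permutation is
a product of at most half as many 3-cycles as it moves points: a cycle of length
at least 3 can be shortened by two points with one 3-cycle, and two disjoint
transpositions can be removed with two. *)

Section ThreeCycleLength.
Import GroupScope.

(** * Upper bound: even permutations as products of 3-cycles *)

Lemma mem_three_cycles {n : nat} {x y z : 'I_n} :
  x != y -> y != z -> z != x -> tperm x y * tperm x z \in three_cycles n.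
Proof.
move=> xy yz zx; rewrite inE; apply/existsP; exists x; apply/existsP; exists y.
apply/existsP; exists z.
have [zy xz] : z != y /\ x != z by split; rewrite eq_sym.
rewrite xy yz zx !permM !tpermL tpermR tpermL (tpermD xy zy) (tpermD xz yz).
rewrite tpermR !eqxx /=.
apply/subsetP=> u; rewrite !inE; apply: contraR; rewrite !negb_or.
by case/andP=> /andP[ux uy] uz; rewrite permM !tpermD // eq_sym.
Qed.

(** Strong induction on the number of moved points: each 3-cycle spent is paid for by two points
    that stop moving. *)
Lemma even_perm_three_cycles {n : nat} (s : {perm 'I_n}) :
  ~~ odd_perm s ->
  exists2 k, 2 * k <= #|[set x | s x != x]| & s \in three_cycles n ^+ k.
Proof.
have [m] := ubnP #|[set x | s x != x]|; elim: m s => // m IHm s lt_m ev_s.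
have [/existsP[x sx2] | /existsPn inv_s] := boolP [exists x, s (s x) != x].
  (* Here [t] sends [x] to [y] to [z] to [x], so [t^-1] followed by [s] fixes [y] and [z] and moves
     no new point. *)
  pose y := s x; pose z := s y; pose t := tperm x y * tperm x z.
  have zx : z != x by [].
  have xy : x != y.
    by apply: contra sx2 => /eqP e; rewrite -/y -e -/y -e.
  have yz : y != z by rewrite (inj_eq perm_inj).
  have t3 := mem_three_cycles xy yz zx.
  have ev_t : odd_perm t = false by rewrite odd_permM !odd_tperm xy eq_sym zx.
  have sub : [set u | (t^-1 * s) u != u] \subset [set u | s u != u] :\: [set y; z].
    apply/subsetP=> u; rewrite !inE; apply: contraR.
    rewrite negb_and !negbK permM invMg !tpermV permM => /orP[/orP[]/eqP->|/eqP su].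
    - by rewrite (tpermD xy) ?tpermR // eq_sym.
    - by rewrite tpermR tpermL.
    have ux : x != u by apply: contra xy => /eqP e; rewrite /y e su.
    have uy : y != u.
      by apply: contra ux => /eqP e; rewrite -(inj_eq (@perm_inj _ s)) su -e.
    have uz : z != u.
      by apply: contra uy => /eqP e; rewrite -(inj_eq (@perm_inj _ s)) su -e.
    by rewrite !tpermD // su.
  have yzs : [set y; z] \subset [set u | s u != u].
    apply/subsetP=> u; rewrite !inE => /orP[]/eqP->; first by rewrite eq_sym.
    by rewrite (inj_eq perm_inj) eq_sym.
  have := subset_leq_card sub; rewrite cardsDS // cards2 yz => le_c.
  have := subset_leq_card yzs; rewrite cards2 yz => ge_c.
  have [||k le_k sk] := IHm (t^-1 * s); first by lia.
    by rewrite odd_permM odd_permV ev_t.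
  exists k.+1; first by lia.
  by rewrite expgS -(mulKVg t s) mem_mulg.
have {}inv_s x : s (s x) = x by apply/eqP; rewrite -[_ == _]negbK inv_s.
have [/existsP[x] | /existsPn s1] := boolP [exists x, s x != x]; last first.
  exists 0 => //; rewrite expg0 inE; apply/eqP/permP=> x.
  by rewrite perm1; apply/eqP; rewrite -[_ == _]negbK s1.
rewrite eq_sym; set y := s x => xy.
(* Now [s] is an involution. A lone transposition would be odd, so there is a second 2-cycle. *)
have [z /and3P[zx zy zsz]] : exists z, [&& z != x, z != y & s z != z].
  apply/existsP; apply: contraR ev_s => /existsPn nz.
  suff -> : s = tperm x y by rewrite odd_tperm xy.
  apply/permP=> z; case: tpermP => [->|->|/eqP zx /eqP zy] //; first exact: inv_s.
  by have := nz z; rewrite zx zy /= negbK => /eqP.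
set w := s z; rewrite eq_sym -/w in zsz.
have wx : w != x by rewrite -(inj_eq (@perm_inj _ s)) inv_s.
have wy : w != y by rewrite (inj_eq perm_inj).
(* The two middle transpositions cancel, so these two 3-cycles give a double transposition; removing
   it frees four points. *)
pose t := (tperm x y * tperm x z) * (tperm z x * tperm z w).
have tE : t = tperm x y * tperm z w.
  by rewrite /t [tperm z x]tpermC -mulgA (mulgA (tperm x z)) tperm2 mul1g.
have t3 : t \in three_cycles n ^+ 2.
  rewrite expgS expg1 mem_mulg ?mem_three_cycles // eq_sym //.
have ev_t : odd_perm t = false by rewrite tE odd_permM !odd_tperm xy zsz.
have sub : [set u | (t^-1 * s) u != u] \subset [set u | s u != u] :\: [set x; y; z; w].
  apply/subsetP=> u; rewrite !inE; apply: contraR.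
  rewrite negb_and !negbK tE permM invMg !tpermV permM.
  case/orP=> [/orP[/orP[/orP[]|]|]/eqP->|/eqP su].
  - by rewrite (tpermD zx wx) tpermL inv_s.
  - by rewrite (tpermD zy wy) tpermR.
  - by rewrite tpermL tpermD ?inv_s // eq_sym.
  - by rewrite tpermR tpermD // eq_sym.
  have fx v : v != s v -> v != u by apply: contra => /eqP->; rewrite su.
  by rewrite !tpermD ?su // fx // inv_s // eq_sym.
have c4 : #|[set x; y; z; w]| = 4.
  rewrite setUC cardsU1 setUC cardsU1 cards2 xy !inE.
  by rewrite (negPf zx) (negPf zy) (negPf wx) (negPf wy) eq_sym (negPf zsz).
have xys : [set x; y; z; w] \subset [set u | s u != u].
  apply/subsetP=> u; rewrite !inE.
  by case/orP=> [/orP[/orP[]|]|]/eqP->; rewrite ?inv_s // eq_sym.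
have := subset_leq_card sub; rewrite cardsDS // c4 => le_c.
have := subset_leq_card xys; rewrite c4 => ge_c.
have [||k le_k sk] := IHm (t^-1 * s); first by lia.
  by rewrite odd_permM odd_permV ev_t.
exists (2 + k); first by lia.
by rewrite expgD -(mulKVg t s) mem_mulg.
Qed.

(** * Lower bound: odd blocks of invariant partitions *)

(* A partition is encoded by the map sending each point to the label of its
   block; [odd_labels f] are the labels of the blocks of odd size. *)
Definition odd_labels {T : finType} (f : T -> T) : {set T} :=
  [set v | odd #|[set u | f u == v]|].

(** Only [a], [b], [c] can stop being odd labels. If all three are odd and distinct, the merged
    block has odd size, as a sum of three odd sizes, and keeps the label [a]. Coincidences among
    them are allowed, since a block may meet a 3-cycle in several points. *)
Lemma card_odd_labels_merge {T : finType} {f g : T -> T} (a b c : T) :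
  (forall u, g u = if f u \in [set a; b; c] then a else f u) ->
  #|odd_labels f| <= #|odd_labels g| + 2.
Proof.
move=> gE.
have out v : v \notin [set a; b; c] -> (v \in odd_labels g) = (v \in odd_labels f).
  move=> nv; rewrite !inE; congr (odd #|pred_of_set _|).
  apply/setP=> u; rewrite !inE gE.
  case: ifP => // fu; have va : v != a.
    by move: nv; rewrite !inE !negb_or; case/andP=> /andP[].
  rewrite eq_sym (negPf va); apply/esym/negbTE; apply: contra nv => /eqP <- //.
have subD : odd_labels f :\: [set a; b; c] \subset odd_labels g :\: [set a; b; c].
  apply/subsetP=> v; rewrite !in_setD => /andP[nv]; rewrite nv /=.
  by rewrite out.
have leD := subset_leq_card subD.
have eqf := cardsID [set a; b; c] (odd_labels f).
have eqg := cardsID [set a; b; c] (odd_labels g).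
have [small|big] := leqP #|odd_labels f :&: [set a; b; c]| 2; first by lia.
have le3 : #|[set a; b; c]| <= 3.
  by rewrite setUC cardsU1 cards2; case: (_ \notin _); case: (a != b).
have card_abc : #|[set a; b; c]| = 3.
  by have := subset_leq_card (subsetIr (odd_labels f) [set a; b; c]); lia.
have /eqP odd_abc : odd_labels f :&: [set a; b; c] == [set a; b; c].
  by rewrite eqEcard subsetIr card_abc.
have [ab nc] : a != b /\ c \notin [set a; b].
  move: card_abc; rewrite setUC cardsU1 cards2.
  by case: (_ \notin _); case: (a != b).
have odd_f v : v \in [set a; b; c] -> odd #|[set u | f u == v]|.
  by rewrite -odd_abc !inE => /andP[].
have ga : a \in odd_labels g :&: [set a; b; c].
  rewrite !inE eqxx andbT.
  have -> : [set u | g u == a] =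
      [set u | f u == a] :|: [set u | f u == b] :|: [set u | f u == c].
    apply/setP=> u; rewrite !inE gE !inE.
    by case: (f u == a) / eqP => [->|]; case: (f u == b);
      case: (f u == c); rewrite ?eqxx //= => /eqP/negPf.
  move: nc; rewrite !inE negb_or => /andP[ca cb].
  rewrite cardsU disjoint_setI0 ?cards0 ?subn0; last first.
    rewrite -setI_eq0; apply/eqP/setP=> u; rewrite !inE.
    by apply/negbTE; apply/negP=> /andP[/orP[]/eqP-> /eqP e]; rewrite e eqxx in ca cb.
  rewrite cardsU disjoint_setI0 ?cards0 ?subn0; last first.
    rewrite -setI_eq0; apply/eqP/setP=> u; rewrite !inE.
    by apply/negbTE; apply/negP=> /andP[/eqP-> /eqP e]; rewrite e eqxx in ab.
  by rewrite !oddD !odd_f // !inE eqxx ?orbT.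
have : 0 < #|odd_labels g :&: [set a; b; c]| by apply/card_gt0P; exists a.
by move: eqf; rewrite odd_abc card_abc; lia.
Qed.

(** The identity preserves the partition into [n] singletons. For a further 3-cycle [t], merging the
    blocks that meet its support suffices, as [t] permutes that support and fixes all other
    points. *)
Lemma three_cycles_invariant_labels {n k : nat} {s : {perm 'I_n}} :
  s \in three_cycles n ^+ k ->
  exists2 f : 'I_n -> 'I_n, forall u, f (s u) = f u & n <= #|odd_labels f| + 2 * k.
Proof.
elim: k s => [|k IHk] s.
  rewrite expg0 => /set1P->; exists id => [u|]; first by rewrite perm1.
  suff -> : odd_labels (@id 'I_n) = setT by rewrite cardsT card_ord leq_addr.
  apply/setP=> v; rewrite !inE.
  by have -> : [set u | u == v] = [set v];
    [apply/setP=> u; rewrite !inE | rewrite cards1].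
rewrite expgS => /mulsgP[t {}s + /IHk[f f_s le_f] ->].
rewrite inE => /existsP[x /existsP[y /existsP[z]]].
case/and5P=> _ _ _ /eqP tx /and3P[/eqP ty /eqP tz t_on].
pose g u := if f u \in [set f x; f y; f z] then f x else f u; exists g; last first.
  apply: leq_trans le_f _; rewrite mulnS addnA leq_add2r.
  exact: card_odd_labels_merge (frefl g).
move=> u; rewrite permM /g f_s.
have [|nu] := boolP (u \in [set x; y; z]); last by rewrite (out_perm t_on).
by rewrite !inE => /orP[/orP[]|]/eqP->; rewrite ?tx ?ty ?tz !eqxx ?orbT.
Qed.

(** The group generated by [s] is a 2-group, so its fixed points in [A] have the parity of
    [#|A|]. *)
Lemma odd_invariant_fixpoint {T : finType} (s : {perm T}) (A : {set T}) :
  involutive s -> (forall u, u \in A -> s u \in A) -> odd #|A| ->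
  exists2 x, x \in A & s x = x.
Proof.
move=> inv_s sA oddA.
have s2 : 2.-group <[s]>.
  rewrite /pgroup -orderE; apply: (@pnat_dvd _ 2) => //; rewrite order_dvdn expgS expg1.
  by apply/eqP/permP=> u; rewrite permM perm1 inv_s.
have actA : [acts <[s]>, on A | 'P].
  rewrite cycle_subG !inE; apply/subsetP=> u; rewrite inE; exact: sA.
have := pgroup_fix_mod s2 actA; rewrite !modn2 oddA.
case: (set_0Vmem 'Fix_(A | 'P)(<[s]>)) => [->|[x]]; first by rewrite cards0.
rewrite inE afix_cycle => /andP[xA /afix1P xs] _; exists x => //; exact: xs.
Qed.

Lemma involution_three_cycles_lb {n k : nat} {s : {perm 'I_n}} :
  involutive s -> (forall x y, s x = x -> s y = y -> x = y) ->
  s \in three_cycles n ^+ k -> n <= 2 * k + 1.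
Proof.
move=> inv_s fix_s /three_cycles_invariant_labels[f f_s le_n].
suff : #|odd_labels f| <= 1 by lia.
have fixp v : v \in odd_labels f -> exists2 x, f x = v & s x = x.
  rewrite inE => /(odd_invariant_fixpoint s _ inv_s)[|x].
    by move=> u; rewrite !inE f_s.
  by rewrite inE => /eqP; exists x.
apply/card_le1_eqP=> v w /fixp[x <- sx] /fixp[y <- sy].
by rewrite (fix_s x y).
Qed.

(** * Reflections of Z/nZ *)

Definition rev_perm (n : nat) : {perm 'I_n} := perm (@rev_ord_inj n).

Lemma odd_rev_perm (n : nat) : odd_perm (rev_perm n) = odd 'C(n, 2).
Proof.
elim: n => [|n IHn].
  have -> : rev_perm 0 = 1 by apply/permP=> -[].
  by rewrite odd_perm1.
(* Deleting 0 and its image [n] leaves the smaller reflection; the lift changes the parity by that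
   of 0 + [n]. *)
have -> : rev_perm n.+1 = lift_perm ord0 ord_max (rev_perm n).
  apply/permP=> i; case: (unliftP ord0 i) => [j|] ->; last first.
    by rewrite lift_perm_id permE; apply: val_inj; rewrite /= subn1.
  rewrite lift_perm_lift !permE; apply: val_inj => /=.
  by rewrite /bump /=; have := ltn_ord j; lia.
by rewrite odd_lift_perm IHn binS bin1 oddD addbC.
Qed.

Lemma shiftX_val (n j : nat) (x : 'I_n) : (shift n ^+ j) x = (x + j) %% n :> nat.
Proof.
elim: j => [|j IHj]; first by rewrite expg0 perm1 addn0 modn_small.
by rewrite expgSr permM permE /= IHj addnS -[in LHS]addn1 modnDml addn1.
Qed.

Lemma odd_permX {T : finType} (s : {perm T}) (m : nat) :
  odd_perm (s ^+ m) = odd m && odd_perm s.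
Proof.
elim: m => [|m IHm]; first by rewrite expg0 odd_perm1.
by rewrite expgS odd_permM IHm /=; case: (odd m); case: (odd_perm s).
Qed.

Lemma odd_shift {n : nat} : odd n -> odd_perm (shift n) = false.
Proof.
move=> odd_n; have := odd_permX (shift n) n; rewrite odd_n /= => <-.
suff -> : shift n ^+ n = 1 by rewrite odd_perm1.
by apply/permP=> x; apply: ord_inj; rewrite shiftX_val perm1 modnDr modn_small.
Qed.

(** This subtraction-free form of the reflection is symmetric in [x] and its image, which makes the
    map an involution. *)
Lemma shiftX_rev_val (n j : nat) (x : 'I_n) :
  (shift n ^+ j * rev_perm n)%g x + (x + j).+1 = 0 %[mod n].
Proof.
rewrite permM permE /= shiftX_val -addnS.
have n_gt0 : 0 < n by case: n x => // -[].
have lt_n := ltn_pmod (x + j) n_gt0; have dE := divn_eq (x + j) n.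
by rewrite (_ : _ + _ = (((x + j) %/ n).+1 * n)%N) ?modnMl ?mod0n // mulSn; lia.
Qed.

Lemma shiftX_rev_involutive (n j : nat) : involutive (shift n ^+ j * rev_perm n).
Proof.
set t := _ * _ => x.
have e1 : t x + (x + j).+1 == 0 %[mod n] by apply/eqP/shiftX_rev_val.
have /eqP := shiftX_rev_val n j (t x); rewrite -/t -(eqP e1).
rewrite (_ : t x + (x + j).+1 = x + (t x + j).+1); last by lia.
by rewrite eqn_modDr !modn_small // => /eqP/val_inj.
Qed.

Lemma shiftX_rev_fixpoint (n j : nat) (x y : 'I_n) : odd n ->
  let t := shift n ^+ j * rev_perm n in t x = x -> t y = y -> x = y.
Proof.
move=> odd_n t tx ty.
have := shiftX_rev_val n j x; rewrite -/t tx -(shiftX_rev_val n j y) -/t ty.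
rewrite !addnS !addnA -!addnS !addnn => /eqP; rewrite eqn_modDr.
(* Fixed points satisfy 2x = 2y modulo the odd number [n]; ordering them makes the difference a
   natural number. *)
wlog le_xy : x y {tx ty} / y <= x => [wlog_xy|].
  by have [/wlog_xy//|/ltnW/wlog_xy le_xy] := leqP y x; rewrite eq_sym => /le_xy.
rewrite eqn_mod_dvd ?leq_double // -doubleB -mul2n Gauss_dvdr ?coprimen2 //.
by rewrite -eqn_mod_dvd // !modn_small // => /eqP/val_inj.
Qed.

(** * Bounds on [h_perm] and [h_coset] *)

Lemma h_perm_three_cycles {n : nat} {s : {perm 'I_n}} :
  ~~ odd_perm s -> s \in three_cycles n ^+ h_perm s.
Proof.
by move=> ev_s; rewrite /h_perm; case: ex_minnP => k + _; rewrite Alt_even ev_s.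
Qed.

Lemma h_perm_le {n : nat} (s : {perm 'I_n}) : odd n -> h_perm s <= n./2.
Proof.
move=> odd_n; rewrite /h_perm; case: ex_minnP => h _ min_h.
(* For odd [s] the defining implication is vacuous, so the exponent 0 qualifies. *)
have [ev_s|odd_s] := boolP (~~ odd_perm s); last first.
  by apply: leq_trans (min_h 0 _) _; rewrite // Alt_even (negPf odd_s).
have [k le_k sk] := even_perm_three_cycles s ev_s.
apply: leq_trans (min_h k _) _; first by rewrite sk implybT.
have := max_card [set x | s x != x]; rewrite card_ord.
by lia.
Qed.

Lemma h_coset_le {n : nat} (s : {perm 'I_n}) : h_coset s <= h_perm s.
Proof.
rewrite /h_coset; elim/big_rec: _ => // t m _ le_m.
by rewrite geq_min le_m orbT.
Qed.

Lemma h_coset_rev_ge (n : nat) :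
  n = 1 %[mod 4] -> n./2 <= h_coset (rev_perm n) /\ ~~ odd_perm (rev_perm n).
Proof.
move=> n4; have odd_n : odd n by lia.
have ev_r : ~~ odd_perm (rev_perm n).
  (* For [n] = 4m + 1 the binomial coefficient is 2m(4m + 1), hence even. *)
  by rewrite odd_rev_perm bin2; nia.
split=> //.
have ge_h j : n./2 <= h_perm (shift n ^+ j * rev_perm n).
  have : ~~ odd_perm (shift n ^+ j * rev_perm n).
    by rewrite odd_permM (negPf ev_r) odd_permX odd_shift // andbF.
  move/h_perm_three_cycles/involution_three_cycles_lb => ge_n.
  have fix_t x y := shiftX_rev_fixpoint n j x y odd_n.
  have := ge_n (shiftX_rev_involutive n j) fix_t.
  by lia.
(* The neutral value of the minimum is the case [j] = 0. *)
rewrite /h_coset; elim/big_rec: _ => [|t m]; first by have := ge_h 0; rewrite mul1g.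
case/rcosetP=> c /cycleP[j ->] -> ge_m; by rewrite leq_min ge_h.
Qed.

End ThreeCycleLength.

Theorem theorem2p6 (n : nat) (n_gt1 : 1 < n) (n_mod4 : n = 1 %[mod 4]) :
  h_max n = (n - 1) %/ 2.
Proof.
have odd_n : odd n by lia.
have -> : (n - 1) %/ 2 = n./2 by lia.
apply/eqP; rewrite eqn_leq; apply/andP; split.
  (* The representative [s] itself already meets the upper bound. *)
  apply/bigmax_leqP=> s _; exact: leq_trans (h_coset_le s) (h_perm_le s odd_n).
have [le_h ev_r] := h_coset_rev_ge n n_mod4.
apply: leq_trans le_h _; apply: (@leq_bigmax_cond _ _ (@h_coset n)).
by rewrite Alt_even.
Qed.
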